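(* Every co-analytic ideal on $\omega$ satisfies the Category Dichotomy.
   Context: An ideal on $\omega$ is a family of subsets of $\omega$ closed under subsets and finite unions, containing $\emptyset$ and not containing $\omega$; it is co-analytic if it is a co-analytic subset of $\mathcal P(\omega)\cong 2^\omega$. $\mathcal I^+=\mathcal P(\omega)\setminus\mathcal I$, $\mathcal I\restriction X=\mathcal I\cap\mathcal P(X)$. For ideals $\mathcal I$ on $X$ and $\mathcal J$ on $Y$, $\mathcal J\le_{\mathsf K}\mathcal I$ if there is $f:X\to Y$ with $f^{-1}(A)\in\mathcal I$ for all $A\in\mathcal J$. $\mathcal{ED}$ is the ideal on $\omega\times\omega$ generated by the columns $\{n\}\times\omega$ and the graphs of functions $\omega\to\omega$; $\mathsf{nwd}$ is the ideal of nowhere dense subsets of $\mathbb Q$. $\mathcal I$ satisfies the Category Dichotomy if $\mathcal I\le_{\mathsf K}\mathsf{nwd}$ or there is $X\in\mathcal I^+$ with $\mathcal{ED}\le_{\mathsf K}\mathcal I\restriction X$. *)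

(* Defs.v *)
From Stdlib Require List.
From mathcomp Require Import all_boot all_order all_algebra.
Unset Printing Implicit Defensive.
Import Order.TTheory GRing.Theory Num.Theory.

Definition preim {X Y : Type} (f : X -> Y) (A : Y -> Prop) : X -> Prop :=
  fun x => A (f x).

Definition is_ideal {X : Type} (I : (X -> Prop) -> Prop) : Prop :=
  I (fun _ => False) /\
  (forall A B : X -> Prop, I B -> (forall x, A x -> B x) -> I A) /\
  (forall A B : X -> Prop, I A -> I B -> I (fun x => A x \/ B x)) /\
  ~ I (fun _ => True).

Definition positive {X : Type} (I : (X -> Prop) -> Prop) (A : X -> Prop) : Prop :=
  ~ I A.

Definition restrict (I : (nat -> Prop) -> Prop) (X : nat -> Prop)
  : ({n : nat | X n} -> Prop) -> Prop :=
  fun B => I (fun n => exists h : X n, B (exist _ n h)).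

Definition katetov_le {X Y : Type} (J : (Y -> Prop) -> Prop)
  (I : (X -> Prop) -> Prop) : Prop :=
  exists f : X -> Y, forall A : Y -> Prop, J A -> I (preim f A).

(* ED: the ideal on nat * nat generated by the columns {n} x nat and the
   graphs of functions nat -> nat, i.e. sets covered by finitely many
   columns (wlog the columns n < N) and finitely many graphs. *)
Definition ED : (nat * nat -> Prop) -> Prop :=
  fun A => exists (N : nat) (fs : seq (nat -> nat)),
    forall n m, A (n, m) -> (n < N)%N \/ (exists2 f, List.In f fs & f n = m).

(* nwd: nowhere dense subsets of Q (order topology): every nonempty open
   interval (a,b) contains a nonempty open interval (c,d) disjoint from A
   (equivalently, the closure of A has empty interior). *)
Definition nwd : (rat -> Prop) -> Prop :=
  fun A => forall a b : rat, (a < b)%R ->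
    exists c d : rat, [/\ (a <= c)%R, (c < d)%R, (d <= b)%R &
      forall q : rat, (c < q)%R -> (q < d)%R -> ~ A q].

Definition baire_cantor_continuous (f : (nat -> nat) -> (nat -> bool)) : Prop :=
  forall (y : nat -> nat) (n : nat), exists m : nat,
    forall z : nat -> nat, (forall i, (i < m)%N -> z i = y i) ->
      forall i, (i < n)%N -> f z i = f y i.

Definition analytic (S : (nat -> bool) -> Prop) : Prop :=
  (forall x, ~ S x) \/
  exists f : (nat -> nat) -> (nat -> bool),
    baire_cantor_continuous f /\ (forall x, S x <-> exists y, f y = x).

Definition coanalytic (I : (nat -> Prop) -> Prop) : Prop :=
  analytic (fun c : nat -> bool => ~ I (fun n => c n = true)).

Definition category_dichotomy (I : (nat -> Prop) -> Prop) : Prop :=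
  katetov_le I nwd \/
  exists Z : nat -> Prop, positive I Z /\ katetov_le ED (restrict I Z).

(* Main.v *)
(** Fix an [I]-positive set [X] and a continuous [f] whose range is the complement
    of [I].  In an unfolded cut-and-choose game, player I plays sets of the ideal,
    player II builds a subset of [X] by choosing points outside of them, together
    with the digits of a [y] such that [f y] is contained in the set built.

    If I can win, the countably many answers of his strategy yield a rank on the
    integers.  Either every selector of the rank is in the ideal, or some positive
    selector can be cut into finite blocks so sparse that the selectors of every
    other block follow the strategy and so are in the ideal; in both cases [ED] is
    below the restriction of [I] to a positive set.

    If I cannot win, there are countably many positive subsets of [X] such that
    every set meeting all of them contains a run of II, hence is positive.  So each
    set in [I] misses one of them.  Iterating this below each of these subsets gives
    a tree of positive sets indexed by finite sequences, and choosing a point from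
    the set of each node maps a dense order to the integers so that preimages of
    sets in [I] are nowhere dense. *)

Require Import Defs.
From mathcomp Require Import all_boot all_order all_algebra.
From mathcomp Require Import boolp zify lra.

(** * Ideals on the integers *)

Section IdealFacts.
Variable J : (nat -> Prop) -> Prop.
Hypothesis JI : is_ideal J.

Lemma ideal0 : J (fun _ => False).
Proof. by case: JI. Qed.

Lemma idealS (A B : nat -> Prop) : J B -> (forall n, A n -> B n) -> J A.
Proof. by case: JI => _ [h _]; apply: h. Qed.

Lemma idealU (A B : nat -> Prop) : J A -> J B -> J (fun n => A n \/ B n).
Proof. by case: JI => _ [_ [h _]]; apply: h. Qed.

Lemma ideal_proper : ~ J (fun _ => True).
Proof. by case: JI => _ [_ [_ h]]. Qed.

Lemma ideal_bigU (D : nat -> nat -> Prop) (k : nat) :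
  (forall i, J (D i)) -> J (fun n => exists2 i, i < k & D i n).
Proof.
move=> JD; elim: k => [|k IH]; first by apply: idealS ideal0 _ => n [].
apply: idealS (idealU _ _ IH (JD k)) _ => n [i].
rewrite ltnS leq_eqVlt => /predU1P[-> |ik] Di; [by right | left].
by exists i.
Qed.

Lemma ideal_lt (k : nat) : (forall a, J (fun n => n = a)) -> J (fun n => n < k).
Proof.
by move=> J1; apply: idealS (ideal_bigU (fun i n => n = i) k J1) _ => n nk; exists n.
Qed.

End IdealFacts.

Arguments ideal0 {J}.
Arguments idealS {J} JI {A B}.
Arguments idealU {J} JI {A B}.
Arguments ideal_proper {J}.
Arguments ideal_bigU {J}.
Arguments ideal_lt {J}.

(** * Deciding the game *)

Definition trace (A : nat -> bool) (n : nat) : seq nat := [seq i <- iota 0 n | A i].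

Lemma traceS (A : nat -> bool) (n : nat) :
  trace A n.+1 = if A n then rcons (trace A n) n else trace A n.
Proof.
by rewrite /trace -addn1 iotaD filter_cat /= add0n; case: (A n); rewrite ?cats0 ?cats1.
Qed.

Lemma mem_trace (A : nat -> bool) (n k : nat) : (k \in trace A n) = A k && (k < n).
Proof. by rewrite mem_filter mem_iota. Qed.

Lemma trace_cat (A : nat -> bool) (N n : nat) : N <= n ->
  trace A n = trace A N ++ trace (fun k => A k && (N <= k)) n.
Proof.
move=> Nn; rewrite /trace -{1 2}(subnKC Nn) iotaD !filter_cat add0n.
have -> : [seq k <- iota 0 N | A k && (N <= k)] = [::].
  rewrite -(filter_pred0 (iota 0 N)); apply: eq_in_filter => k.
  by rewrite mem_iota add0n /= ltnNge => /negbTE ->; rewrite andbF.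
congr (_ ++ _); apply: eq_in_filter => k.
by rewrite mem_iota => /andP[->]; rewrite andbT.
Qed.

(* Player II enumerates [A] increasingly, and player I's answer [B] only depends on
   the points played so far. *)
Definition follows (B : seq nat -> nat -> Prop) (A : nat -> bool) : Prop :=
  forall n, A n -> ~ B (trace A n) n.

Definition extends (y : nat -> nat) (w : seq nat) : Prop :=
  forall i, i < size w -> y i = nth 0 w i.

Section Game.
Variables (J : (nat -> Prop) -> Prop) (X : nat -> Prop).
Variable f : (nat -> nat) -> nat -> bool.
Hypothesis JI : is_ideal J.

(* [u] lists the points and [w] the digits already played.  The last clause requires
   the points of [f y] below [size w] to be played before the next digit; this is
   what makes the union of an infinite run contain [f y]. *)
Definition target (u w : seq nat) (A : nat -> bool) : Prop :=
  exists y, [/\ extends y w, forall k, f y k -> X k /\ (k \in u \/ A k) &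
                forall k, k < size w -> f y k -> k \in u].

Definition avoidable (u w : seq nat) : Prop :=
  exists B : seq nat -> nat -> Prop, (forall v, J (B v)) /\
    forall A, follows B A -> ~ target u w A.

(* [reachable] is a countable substitute for II being able to force a further digit
   without losing: any set [A] meeting all the [Y s] contains the points to play. *)
Definition reachable (u w : seq nat) : Prop :=
  exists Y : seq nat -> nat -> Prop, (forall s, ~ J (Y s)) /\
    forall A : nat -> Prop, (forall s, exists2 n, A n & Y s n) ->
      exists (v : seq nat) (d : nat),
        (forall n, n \in v -> A n) /\ ~ avoidable (u ++ v) (rcons w d).

(** Were this set positive, putting it in front of the families witnessing [reachable (rcons u n) w]
    would witness [reachable u w]. *)
Lemma reachable_rcons (u w : seq nat) :
  ~ reachable u w -> J (fun n => reachable (rcons u n) w).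
Proof.
move=> nR; apply: contrapT => nJ; apply: nR.
have /choice[G GP] : forall n, exists Y : seq nat -> nat -> Prop,
    (forall s, ~ J (Y s)) /\ (reachable (rcons u n) w ->
      forall A : nat -> Prop, (forall s, exists2 n, A n & Y s n) ->
      exists (v : seq nat) (d : nat),
        (forall n, n \in v -> A n) /\ ~ avoidable (rcons u n ++ v) (rcons w d)).
  move=> n; have [[Y [Yp YA]]|nR] := pselect (reachable (rcons u n) w).
    by exists Y.
  by exists (fun _ _ => True); split=> // _; apply: ideal_proper.
exists (fun s => if s is n :: s' then G n s' else fun n => reachable (rcons u n) w).
split=> [[|n s]|A hA] //=; first by case: (GP n).
have [n An Rn] := hA [::].
have [v [d [vA nE]]] := (GP n).2 Rn A (fun s => hA (n :: s)).
exists (n :: v), d; split; last by rewrite -cat_rcons.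
by move=> m; rewrite inE => /predU1P[->|/vA].
Qed.

Lemma avoidable_rcons (u w : seq nat) (d : nat) :
  ~ reachable u w -> avoidable u (rcons w d).
Proof.
move=> nR; apply: contrapT => nE; apply: nR.
exists (fun _ _ => True); split=> [_|A _]; first exact: ideal_proper.
by exists [::], d; rewrite cats0.
Qed.

(* Player I keeps away from [reachable] and at the same time follows his strategies
   against every digit [d] played after any initial part of the run.  Finitely many
   of these suffice at each stage, since II may delay [d] until the sum of her
   points exceeds it. *)
Lemma unavoidable_reachable (u w : seq nat) : ~ avoidable u w -> reachable u w.
Proof.
move=> nE; apply: contrapT => nR; apply: nE.
have /choice[S SP] : forall p : seq nat * nat, exists B : seq nat -> nat -> Prop,
    (forall v, J (B v)) /\ (avoidable p.1 (rcons w p.2) ->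
      forall A, follows B A -> ~ target p.1 (rcons w p.2) A).
  move=> p; have [[B [BJ BA]]|nE] := pselect (avoidable p.1 (rcons w p.2)).
    by exists B.
  by exists (fun _ _ => False); split=> // _; apply: ideal0.
(* Here [i] is the moment at which [d] is played, and [drop i v] the run after it. The guard
   [~ reachable (u ++ v) w] keeps [B v] in the ideal for every [v]. *)
pose B v n := (~ reachable (u ++ v) w /\ reachable (rcons (u ++ v) n) w) \/
  exists2 i, i < (size v).+1 & exists2 d, d < (sumn v).+1 &
    S (u ++ take i v, d) (drop i v) n.
exists B; split=> [v|A fA [y [yw yA yu]]].
  apply: idealU => //.
    have [R|nR'] := pselect (reachable (u ++ v) w).
      by apply: (idealS JI (ideal0 JI)) => n [].
    by apply: (idealS JI (reachable_rcons _ _ nR')) => n [].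
  apply: ideal_bigU => // i; apply: ideal_bigU => // d.
  by case: (SP (u ++ take i v, d)).
have nRA n : ~ reachable (u ++ trace A n) w.
  elim: n => [|n IH]; first by rewrite cats0.
  rewrite traceS; case: ifP => // An; rewrite -rcons_cat => R.
  by apply: (fA n An); left.
pose d := y (size w).
(* A point of [A] beyond both bounds makes the later sums at least [d]; without one, no point of [A]
   is left after [N]. The bound [size w < N] serves the last clause of [target]. *)
have [N [wN Nd]] : exists N, size w < N /\
    forall n, N <= n -> A n -> d <= sumn (trace A n).
  have [[a [Aa]]|none] := pselect (exists a, A a /\ maxn d (size w).+1 <= a).
    rewrite geq_max => /andP[da wa]; exists a.+1; split; first exact: ltnW.
    move=> n an _; apply: leq_trans da _.
    have : a \in trace A n by rewrite mem_trace Aa.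
    elim: (trace A n) => //= x s IH; rewrite inE => /predU1P[->|/IH h].
      exact: leq_addr.
    exact: leq_trans h (leq_addl _ _).
  exists (maxn d (size w).+1); split; first by rewrite leq_maxr.
  by move=> n Nn An; case: none; exists n.
pose A' k := A k && (N <= k).
have : ~ target (u ++ trace A N) (rcons w d) A'.
  apply: (SP (u ++ trace A N, d)).2; first exact: (avoidable_rcons _ _ _ (nRA N)).
  move=> n /andP[An Nn] Sn; apply: (fA n An); right.
  have tE := trace_cat A N n Nn.
  exists (size (trace A N)); first by rewrite ltnS tE size_cat leq_addr.
  exists d; first by rewrite ltnS Nd.
  by rewrite tE take_size_cat // drop_size_cat.
case; exists y; split.
- move=> i; rewrite size_rcons ltnS nth_rcons leq_eqVlt => /predU1P[->|iw].
    by rewrite ltnn eqxx.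
  by rewrite iw yw.
- move=> k /yA[Xk kA]; split=> //; rewrite mem_cat mem_trace /A'.
  case: kA => [-> |->]; first by left.
  by case: ltnP => _ /=; rewrite ?orbT; [left | right].
- move=> k; rewrite size_rcons => kw /yA[_]; rewrite mem_cat mem_trace.
  by case=> ->; rewrite ?(leq_trans kw wN) ?orbT.
Qed.

Hypothesis fcont : baire_cantor_continuous f.
Hypothesis Jpos : forall A : nat -> Prop,
  ~ J A <-> exists y, forall k, f y k -> X k /\ A k.

(** The family collects the sets attached to all unavoidable positions. Inside a set of the ideal
    meeting all of them, II could play forever, and her digits would contradict [Jpos]. *)
Lemma unavoidable_family : ~ avoidable [::] [::] ->
  exists Y : nat -> nat -> Prop, (forall i, ~ J (Y i)) /\
    forall A, J A -> exists i, forall n, Y i n -> ~ A n.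
Proof.
move=> nE0.
have /choice[G GP] : forall p : seq nat * seq nat,
    exists Y : seq nat -> nat -> Prop,
    (forall s, ~ J (Y s)) /\ (~ avoidable p.1 p.2 ->
      forall A : nat -> Prop, (forall s, exists2 n, A n & Y s n) ->
      exists p' : seq nat * seq nat, [/\
        forall n, n \in p'.1 -> n \in p.1 \/ A n,
        exists d, p'.2 = rcons p.2 d & ~ avoidable p'.1 p'.2]).
  move=> [u w] /=; have [E|nE] := pselect (avoidable u w).
    by exists (fun _ _ => True); split=> // _; apply: ideal_proper.
  have [Y [Yp YA]] := unavoidable_reachable _ _ nE.
  exists Y; split=> // _ A /YA[v [d [vA nE']]].
  exists (u ++ v, rcons w d) => /=; split=> //; last by exists d.
  by move=> n; rewrite mem_cat => /orP[->|/vA]; [left | right].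
exists (fun i => if unpickle i is Some (p, s) then G p s else fun _ => True).
split=> [i|A JA].
  by case: (unpickle i) => [[p s]|]; [case: (GP p) | apply: ideal_proper].
apply: contrapT => hit.
have {}hit p s : exists2 n, A n & G p s n.
  apply: contrapT => nh; apply: hit; exists (pickle (p, s)) => n.
  by rewrite pickleK => Gn An; apply: nh; exists n.
have /choice[nx nxP] : forall p : seq nat * seq nat,
    exists p' : seq nat * seq nat, ~ avoidable p.1 p.2 -> [/\
        forall n, n \in p'.1 -> n \in p.1 \/ A n,
        exists d, p'.2 = rcons p.2 d & ~ avoidable p'.1 p'.2].
  move=> p; have [E|nE] := pselect (avoidable p.1 p.2); first by exists p.
  by have [p' p'P] := (GP p).2 nE A (hit p); exists p'.
pose P j := iter j nx ([::], [::]).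
have nEP j : ~ avoidable (P j).1 (P j).2.
  by elim: j => //= j /nxP[].
have uA j n : n \in (P j).1 -> A n.
  elim: j => // j IH; have [h _ _] := nxP _ (nEP j).
  by case/h => // /IH.
have sz j : size (P j).2 = j.
  elim: j => // j IH; have [_ [d dE] _] := nxP _ (nEP j).
  by rewrite /= dE size_rcons IH.
pose y j := nth 0 (P j.+1).2 j.
have yE j i : i < j -> nth 0 (P j).2 i = y i.
  elim: j => // j IH; rewrite ltnS leq_eqVlt => /predU1P[->//|ij].
  have [_ [d dE] _] := nxP _ (nEP j).
  by rewrite /= dE nth_rcons sz ij IH.
suff : ~ J A by [].
apply/Jpos; exists y => k fyk.
(* By continuity [f z k] holds for any [z] extending the digits at position [j]. Unavoidability
   provides such a [z] for which [k], being below [j], is already played. *)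
have [m ym] := fcont y k.+1.
pose j := maxn m k.+1.
have [z [zw zX zu]] : exists z, [/\ extends z (P j).2,
    forall k, f z k -> X k & forall k, k < j -> f z k -> k \in (P j).1].
  apply: contrapT => nz; apply: (nEP j).
  exists (fun _ _ => False); split=> [_|A' _ [z [zw zX zu]]]; first exact: ideal0.
  by apply: nz; exists z; split=> // [k' /zX[]|k' k'j]; last by apply: zu; rewrite sz.
have kj : k < j by rewrite leq_maxr.
have fzk : f z k.
  rewrite (ym z) // => i im; have ij : i < j by rewrite (leq_trans im) ?leq_maxl.
  by rewrite zw ?sz // yE.
by split; [apply: zX | apply: (uA j); apply: zu].
Qed.

End Game.

(** * Katetov reductions of ED *)

(** Under the map sending [n] to [(p n, n)], columns pull back to pieces of the partition and graphs
    to selectors. *)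
Lemma katetov_ED_of_partition (I : (nat -> Prop) -> Prop) (Z : nat -> Prop)
    (p : nat -> nat) : is_ideal I ->
  (forall N, I (fun n => Z n /\ p n = N)) ->
  (forall A : nat -> Prop, (forall n, A n -> Z n) ->
    (forall m n, A m -> A n -> p m = p n -> m = n) -> I A) ->
  katetov_le ED (restrict I Z).
Proof.
move=> iI colI selI; exists (fun x => (p (proj1_sig x), proj1_sig x)) => A [N [fs Afs]].
have fsI : I (fun n => exists2 g, List.In g fs & Z n /\ g (p n) = n).
  elim: fs {Afs} => [|g fs IH]; first by apply: (idealS iI (ideal0 iI)) => n [].
  have gI : I (fun n => Z n /\ g (p n) = n).
    by apply: selI => [n []//|m n [_ gm] [_ gn] pmn]; rewrite -gm -gn pmn.
  apply: (idealS iI (idealU iI gI IH)) => n [h [<-|hfs] Zn]; first by left.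
  by right; exists h.
apply: (idealS iI (idealU iI (ideal_bigU iI _ N colI) fsI)) => n [Zn].
by case/Afs => [pN|[g gfs gn]]; [left; exists (p n) | right; exists g].
Qed.

Lemma trace_bound (g : seq nat -> nat) (m : nat) :
  exists c, forall A, g (trace A m) <= c.
Proof.
elim: m g => [|m IH] g; first by exists (g [::]).
have [c cP] := IH (fun s => maxn (g s) (g (rcons s m))).
exists c => A; apply: leq_trans (cP A); rewrite traceS.
by case: ifP => _; rewrite ?leq_maxl ?leq_maxr.
Qed.

Section Selectors.
Variable J : (nat -> Prop) -> Prop.
Hypothesis JI : is_ideal J.
Hypothesis J1 : forall a, J (fun n => n = a).
Variable B : seq nat -> nat -> Prop.
Hypothesis BJ : forall v, J (B v).
Hypothesis BA : forall A, follows B A -> J (fun n => A n).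

(** The rank of [n] is the least among [n] itself and the codes of the [v] with [B v n], so bounded
    rank confines [n] to a finite union of sets in [J]. *)
Lemma rank_exists : exists lev : nat -> nat,
  (forall m, J (fun n => lev n <= m)) /\
  (forall v n, pickle v < lev n -> ~ B v n).
Proof.
have ex n : exists m, `[< n = m \/ exists2 v, pickle v = m & B v n >].
  by exists n; apply/asboolP; left.
exists (fun n => ex_minn (ex n)); split=> [m|v n].
  have D := ideal_bigU JI (fun i n => n = i \/ exists2 v, pickle v = i & B v n) m.+1.
  apply: (idealS JI (D _)) => // [i|n].
    apply: idealU => //; case E: (unpickle i : option (seq nat)) => [v|].
      by apply: (idealS JI (BJ v)) => n [w wi]; move: E; rewrite -wi pickleK => -[->].
    by apply: (idealS JI (ideal0 JI)) => n [w wi]; move: E; rewrite -wi pickleK.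
  by case: ex_minnP => k /asboolP kP _ km; exists k.
case: ex_minnP => k _ kmin vk Bvn; move: vk; rewrite ltnNge => /negP; apply.
by apply: kmin; apply/asboolP; right; exists v.
Qed.

Lemma selector_partition : exists (Z : nat -> Prop) (p : nat -> nat),
  [/\ ~ J Z, forall N, J (fun n => Z n /\ p n = N) &
    forall A : nat -> Prop, (forall n, A n -> Z n) ->
      (forall m n, A m -> A n -> p m = p n -> m = n) -> J A].
Proof.
have [lev [levJ levB]] := rank_exists.
have [sel|] := pselect (forall A : nat -> Prop,
    (forall m n, A m -> A n -> lev m = lev n -> m = n) -> J A).
  exists (fun _ => True), lev; split=> [|N|A _]; first exact: ideal_proper.
    by apply: (idealS JI (levJ N)) => n [_ ->].
  exact: sel.
case/existsNP => S /not_implyP[Sinj SJ].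
(* A selector has at most one point of each rank, hence finitely many of rank at most [c]. *)
have low c : exists M, forall n, S n -> lev n <= c -> n < M.
  elim: c => [|c [M MP]].
    have [[n [Sn ln]]|none] := pselect (exists n, S n /\ lev n <= 0).
      exists n.+1 => k Sk lk; rewrite ltnS (Sinj k n) //.
      by move: lk ln; rewrite !leqn0 => /eqP-> /eqP->.
    by exists 0 => n Sn ln; case: none; exists n.
  have [[n [Sn ln]]|none] := pselect (exists n, S n /\ lev n = c.+1).
    exists (maxn M n.+1) => k Sk; rewrite leq_eqVlt => /predU1P[lk|lk].
      by rewrite (Sinj k n) ?lk ?ln // leq_maxr.
    by apply: leq_trans (MP k Sk lk) _; apply: leq_maxl.
  exists M => k Sk; rewrite leq_eqVlt => /predU1P[lk|lk]; last exact: MP.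
  by case: none; exists k.
(* The finitely many traces below [m] have bounded codes, which the ranks of late points of [S]
   exceed. *)
have /choice[nx nxP] : forall m, exists M, m < M /\
    forall A n, S n -> M <= n -> pickle (trace A m) < lev n.
  move=> m; have [c cP] := trace_bound pickle m; have [M MP] := low c.
  exists (maxn M m.+1); split=> [|A n Sn]; first exact: leq_maxr.
  rewrite geq_max => /andP[Mn _]; rewrite ltnNge; apply/negP => h.
  have := MP n Sn (leq_trans h (cP A)).
  by rewrite ltnNge Mn.
pose mm i := iter i nx 0.
have mmS i : mm i < mm i.+1 by case: (nxP (mm i)).
have mmle i j : i <= j -> mm i <= mm j.
  move/subnKC <-; elim: (j - i) => [|k IH]; first by rewrite addn0.
  by rewrite addnS (leq_trans IH) // ltnW.
have exb n : exists i, n < mm i.+1.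
  by exists n; elim: n => [|n IH]; [apply: mmS | apply: leq_ltn_trans IH (mmS _)].
pose blk n := ex_minn (exb n).
have blk_lt n : n < mm (blk n).+1 by rewrite /blk; case: ex_minnP.
have blk_ge n : mm (blk n) <= n.
  rewrite /blk; case: ex_minnP => -[|i] _ imin //; rewrite leqNgt; apply/negP => /imin.
  by rewrite ltnn.
have blk_mono m n : m <= n -> blk m <= blk n.
  move=> mn; rewrite leqNgt; apply/negP => h.
  have := leq_ltn_trans mn (blk_lt n).
  by rewrite ltnNge (leq_trans (mmle _ _ h) (blk_ge m)).
(* Blocks of one parity only: the predecessors in block order then lie below
   [mm (blk n).-1], so that [nxP] applies to the trace. *)
have [b Zb] : exists b, ~ J (fun n => [/\ S n, 0 < blk n & odd (blk n) = b]).
  apply: contrapT => /forallNP h; apply: SJ.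
  have Jb b : J (fun n => [/\ S n, 0 < blk n & odd (blk n) = b]).
    by apply: contrapT; apply: h.
  apply: (idealS JI (idealU JI (ideal_lt JI (mm 1) J1)
    (idealU JI (Jb true) (Jb false)))) => n Sn.
  case: (posnP (blk n)) => [b0|b0]; first by left; have := blk_lt n; rewrite b0.
  by right; case ob: (odd (blk n)); [left | right].
exists (fun n => [/\ S n, 0 < blk n & odd (blk n) = b]), blk; split=> // [N|A AZ Ainj].
  apply: (idealS JI (ideal_lt JI (mm N.+1) J1)) => n [_ <-]; exact: blk_lt.
have : J (fun n => `[< A n >]).
  apply: BA => n /asboolP An.
  have [Sn b0 bn] := AZ n An.
  have trE : trace (fun k => `[< A k >]) n = trace (fun k => `[< A k >]) (mm (blk n).-1).
    have le : mm (blk n).-1 <= n by apply: leq_trans (blk_ge n); apply: mmle; apply: leq_pred.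
    rewrite (trace_cat _ _ _ le) -[RHS]cats0; congr (_ ++ _).
    case E: (trace _ n) => [//|k s]; exfalso.
    have : k \in k :: s by apply: mem_head.
    rewrite -E mem_trace => /andP[/andP[/asboolP Ak mk] kn].
    have [Sk bk0 bk] := AZ k Ak.
    have : blk k < (blk n).-1.
      have := blk_mono _ _ (ltnW kn); rewrite leq_eqVlt => /predU1P[Ebl|].
        by move: kn; rewrite (Ainj _ _ Ak An Ebl) ltnn.
      rewrite -[in X in X -> _](prednK b0) ltnS leq_eqVlt => /predU1P[Ebl|//].
      move: bk; rewrite Ebl -bn -[in RHS](prednK b0) /=; by case: (odd _).
    by move/mmle; rewrite leqNgt => /negP; apply; apply: leq_ltn_trans mk (blk_lt k).
  apply: levB; rewrite trE; apply: (nxP _).2 => //.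
  by have := blk_ge n; rewrite -{1}(prednK b0).
by move=> h; apply: (idealS JI h) => n An; apply/asboolP.
Qed.

End Selectors.

(** * Katetov reductions to nwd *)

Section Dyadic.
Import Order.TTheory GRing.Theory Num.Theory.
Local Open Scope ring_scope.

Lemma avoid_small_codes (k : nat) (c d : rat) : c < d ->
  exists c' d', [/\ c <= c', c' < d', d' <= d &
    forall q : rat, c' < q -> q < d' -> (k <= pickle q)%N].
Proof.
move=> cd; elim: k => [|k [c' [d' [cc' cd' dd' h]]]]; first by exists c, d.
have [[q0 [k0 c0 d0]]|none] :=
    pselect (exists q0 : rat, [/\ pickle q0 = k, c' < q0 & q0 < d']).
  exists c', q0; split=> //; first exact: le_trans (ltW d0) dd'.
  move=> q cq qq0; rewrite ltn_neqAle h ?(lt_trans qq0) // andbT.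
  apply/eqP; rewrite -k0 => /(pcan_inj pickleK) E.
  by move: qq0; rewrite E ltxx.
exists c', d'; split=> // q cq qd; rewrite ltn_neqAle h // andbT.
by apply/eqP => kq; apply: none; exists q.
Qed.

Definition cell_lo (j : nat) (z : int) : rat := z%:~R / 2 ^+ j.
Definition cell_hi (j : nat) (z : int) : rat := (z + 1)%:~R / 2 ^+ j.

Lemma cell_lt (j : nat) (z : int) : cell_lo j z < cell_hi j z.
Proof.
by rewrite ltr_pM2r ?invr_gt0 ?exprn_gt0 // ltr_int ltrDl.
Qed.

Lemma cell_floor (j : nat) (z : int) (q : rat) :
  cell_lo j z < q -> q < cell_hi j z -> Num.floor (2 ^+ j * q) = z.
Proof.
have p : 0 < 2 ^+ j :> rat by rewrite exprn_gt0.
rewrite /cell_lo /cell_hi ltr_pdivrMr // ltr_pdivlMr // mulrC => h1 h2.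
by apply: floor_def; rewrite (ltW h1).
Qed.

Lemma cell_dense (a b : rat) : a < b ->
  exists j z, a <= cell_lo j z /\ cell_hi j z <= b.
Proof.
move=> ab.
have [j jP] : exists j, 2 <= 2 ^+ j * (b - a).
  exists (Num.bound (2 / (b - a))).
  have ba : 0 < b - a by rewrite subr_gt0.
  rewrite -ler_pdivrMr //; apply: ltW; apply: lt_le_trans (archi_boundP _) _.
    by rewrite divr_ge0 ?ltW.
  by rewrite -natrX ler_nat ltnW // ltn_expl.
have p : 0 < 2 ^+ j :> rat by rewrite exprn_gt0.
exists j, (Num.floor (2 ^+ j * a) + 1).
rewrite /cell_lo /cell_hi ler_pdivlMr // ler_pdivrMr //.
have := floor_itv (2 ^+ j * a); rewrite !rmorphD /= => /andP[]; lra.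
Qed.

Lemma cell_child (j : nat) (z e : int) : (e == 0) || (e == 1) ->
  cell_lo j z <= cell_lo j.+1 (2 * z + e) /\
  cell_hi j.+1 (2 * z + e) <= cell_hi j z.
Proof.
have half x : x / 2 ^+ j.+1 = x / 2 / 2 ^+ j :> rat by rewrite exprS invfM mulrA.
rewrite /cell_lo /cell_hi !half !ler_pM2r ?invr_gt0 ?exprn_gt0 // !rmorphD !rmorphM /=.
by case/orP=> /eqP-> /=; split; lra.
Qed.

Lemma floor_half (j : nat) (q : rat) :
  Num.floor (2 ^+ j * q) = (Num.floor (2 ^+ j.+1 * q) %/ 2)%Z.
Proof.
rewrite exprS -mulrA; set x := 2 ^+ j * q; set z := Num.floor (2 * x).
have /andP[z1 z2] := floor_itv (2 * x); rewrite -/z in z1 z2.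
have [k1 k2] : 2 * (z %/ 2)%Z <= z /\ z + 1 <= 2 * (z %/ 2)%Z + 2 by lia.
move: k1 k2; rewrite -!(ler_int rat) !rmorphD !rmorphM /= => k1 k2.
move: z2; rewrite rmorphD /= => z2.
by apply: floor_def; rewrite rmorphD /=; apply/andP; split; lra.
Qed.

Variable Phi : (nat -> Prop) -> nat -> nat -> Prop.

(* Binary digits drive the descent through the tree of iterated [Phi]: a digit 1
   increments a counter, a digit 0 passes to the child it points to. *)
Fixpoint descent (j : nat) (z : int) : (nat -> Prop) * nat :=
  if j is j'.+1 then
    let s := descent j' (z %/ 2)%Z in
    if (z %% 2)%Z == 1 then (s.1, s.2.+1) else (Phi s.1 s.2, 0%N)
  else ((fun _ => True), 0%N).

Lemma descentS (j : nat) (z : int) : descent j.+1 z =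
  let s := descent j (z %/ 2)%Z in
  if (z %% 2)%Z == 1 then (s.1, s.2.+1) else (Phi s.1 s.2, 0%N).
Proof. by []. Qed.

Lemma descent_child (j : nat) (z : int) :
  descent j.+1 (2 * z + 1) = ((descent j z).1, (descent j z).2.+1) /\
  descent j.+1 (2 * z + 0) = (Phi (descent j z).1 (descent j z).2, 0%N).
Proof.
rewrite !descentS.
have [-> ->] : ((2 * z + 0) %/ 2)%Z = z /\ ((2 * z + 1) %/ 2)%Z = z by lia.
have [-> ->] : ((2 * z + 0) %% 2)%Z = 0 /\ ((2 * z + 1) %% 2)%Z = 1 by lia.
by [].
Qed.

(** Repeatedly taking the right half appends digits 1, which only raise the counter. *)
Lemma descent_count (j : nat) (z : int) (m : nat) : exists j' z',
  [/\ cell_lo j z <= cell_lo j' z', cell_hi j' z' <= cell_hi j z &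
    descent j' z' = ((descent j z).1, (descent j z).2 + m)%N].
Proof.
elim: m => [|m [j' [z' [lo hi E]]]].
  by exists j, z; split=> //; rewrite addn0; case: (descent j z).
have [lo' hi'] := cell_child j' z' 1 isT.
exists j'.+1, (2 * z' + 1); split; [exact: le_trans lo lo' | exact: le_trans hi' hi |].
by rewrite (descent_child j' z').1 E addnS.
Qed.

Lemma katetov_nwd_of_families (I : (nat -> Prop) -> Prop) : is_ideal I ->
  (forall Y, ~ I Y -> [/\ forall i, ~ I (Phi Y i), forall i n, Phi Y i n -> Y n &
     forall A, I A -> exists i, forall n, Phi Y i n -> ~ A n]) ->
  katetov_le I nwd.
Proof.
move=> iI PhiP.
have pos j z : ~ I (descent j z).1.
  elim: j z => [|j IH] z /=; first exact: ideal_proper.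
  by case: ifP => _ //=; case: (PhiP _ (IH (z %/ 2)%Z)).
have sub j k (q : rat) : (j <= k)%N -> forall n,
    (descent k (Num.floor (2 ^+ k * q))).1 n ->
    (descent j (Num.floor (2 ^+ j * q))).1 n.
  move/subnKC <-; elim: (k - j)%N => [|i IH] n; first by rewrite addn0.
  rewrite addnS descentS -floor_half => h; apply: IH; move: h => /=.
  by case: ifP => _ //=; case: (PhiP _ (pos (j + i)%N (Num.floor (2 ^+ (j + i) * q)))) => _ + _; apply.
have /choice[f fP] : forall q : rat, exists n,
    (descent (pickle q) (Num.floor (2 ^+ pickle q * q))).1 n.
  move=> q; apply: contrapT => /forallNP none.
  apply: (pos (pickle q) (Num.floor (2 ^+ pickle q * q))).
  exact: (idealS iI (ideal0 iI) none).
(* The choice at depth [pickle q] respects any fixed depth for all but finitely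
   many [q], and these are avoided by shrinking the interval. *)
exists f => A IA a b ab.
(* Inside [(a, b)], a digit 0 resets the counter, [m] digits 1 raise it to [m], and a final 0
   selects the child that misses [A]. *)
have [j [z [lo hi]]] := cell_dense a b ab.
have [lo0 hi0] := cell_child j z 0 isT.
have /PhiP[_ _ /(_ A IA)[m mP]] := pos j.+1 (2 * z + 0).
have [j' [z' [lo1 hi1 E]]] := descent_count j.+1 (2 * z + 0) m.
have [lo2 hi2] := cell_child j' z' 0 isT.
have E' : (descent j'.+1 (2 * z' + 0)).1 = Phi (descent j.+1 (2 * z + 0)).1 m.
  have : (descent j.+1 (2 * z + 0)).2 = 0%N by rewrite (descent_child j z).2.
  rewrite (descent_child j' z').2 E.
  by case: (descent j.+1 (2 * z + 0)) => Y i /= ->.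
have [c [d [cc cd dd cdP]]] := avoid_small_codes j'.+1 _ _ (cell_lt j'.+1 (2 * z' + 0)).
exists c, d; split.
- exact: le_trans (le_trans lo lo0) (le_trans lo1 (le_trans lo2 cc)).
- exact: cd.
- exact: le_trans dd (le_trans hi2 (le_trans hi1 (le_trans hi0 hi))).
move=> q cq qd; apply: mP; rewrite -E'.
rewrite -(cell_floor j'.+1 (2 * z' + 0) q).
- exact: (sub _ _ q (cdP q cq qd) _ (fP q)).
- exact: le_lt_trans cc cq.
- exact: lt_le_trans qd dd.
Qed.

End Dyadic.

(** * The dichotomy below a positive set and for the whole ideal *)

Lemma positive_dichotomy (I : (nat -> Prop) -> Prop) (X : nat -> Prop) :
  is_ideal I -> (forall a, I (fun n => n = a)) -> coanalytic I -> ~ I X ->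
  (exists Z, positive I Z /\ katetov_le ED (restrict I Z)) \/
  exists Y : nat -> nat -> Prop, [/\ forall i, ~ I (Y i), forall i n, Y i n -> X n &
    forall A, I A -> exists i, forall n, Y i n -> ~ A n].
Proof.
move=> iI I1 cI Xpos; pose J A := I (fun n => A n /\ X n).
have JI : is_ideal J.
  split; first by apply: (idealS iI (ideal0 iI)) => n [].
  split=> [A A' JA' AA'|]; first by apply: (idealS iI JA') => n [/AA'].
  split=> [A A' JA JA'|JT].
    by apply: (idealS iI (idealU iI JA JA')) => n [[An|An] Xn]; [left | right].
  by apply: Xpos; apply: (idealS iI JT).
have J1 a : J (fun n => n = a) by apply: (idealS iI (I1 a)) => n [].
case: cI => [none|[f [fcont fP]]].
  case: (none (fun n => `[< X n >])) => IX; apply: Xpos.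
  by apply: (idealS iI IX) => n Xn; apply/asboolP.
(* A positive [A] yields a [y] for which [f y] is exactly the intersection of [A] and [X]; the
   converse is closure of [I] under subsets. *)
have Jpos (A : nat -> Prop) : ~ J A <-> exists y, forall k, f y k -> X k /\ A k.
  split=> [nJ|[y yA] JA].
    have /fP[y yE] : ~ I (fun n => `[< A n /\ X n >] = true).
      by move=> IA; apply: nJ; apply: (idealS iI IA) => n An; apply/asboolP.
    by exists y => k; rewrite yE => /asboolP[].
  have /fP : exists y', f y' = f y by exists y.
  by apply; apply: (idealS iI JA) => n /yA[].
have [[B [BJ BA]]|nE] := pselect (avoidable J X f [::] [::]).
  have {}BA A : follows B A -> J (fun n => A n).
    move=> /BA nt; apply: contrapT => /Jpos[y yA]; apply: nt.
    by exists y; split=> // k /yA[Xk Ak]; split; last right.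
  have [Z [p [Zpos Zp Zsel]]] := selector_partition J JI J1 B BJ BA.
  left; exists (fun n => Z n /\ X n); split=> //.
  apply: (katetov_ED_of_partition _ _ p iI) => [N|A AZ Ainj].
    by apply: (idealS iI (Zp N)) => n [[Zn Xn] pn].
  have JA : J A by apply: Zsel => // n /AZ[].
  by apply: (idealS iI JA) => n An; split=> //; case: (AZ n An).
right; have [Y [Ypos YA]] := unavoidable_family J X f JI fcont Jpos nE.
exists (fun i n => Y i n /\ X n); split=> [i|i n []|A IA] //; first exact: Ypos.
have [|i Yi] := YA A; first by apply: (idealS iI IA) => n [].
by exists i => n [/Yi].
Qed.

Theorem theorem50 (I : (nat -> Prop) -> Prop) :
  is_ideal I -> coanalytic I -> category_dichotomy I.
Proof.
(* If some singleton is not in [I], no set in [I] contains its point, so a constant map reduces [I]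
   to [nwd]. *)
move=> iI cI; have [I1|] := pselect (forall a, I (fun n => n = a)); last first.
  case/existsNP => a Ia; left; exists (fun _ => a) => A IA c d cd.
  exists c, d; split=> // q _ _ Aa; apply: Ia.
  by apply: (idealS iI IA) => n ->.
have [ED_I|nED] := pselect (exists Z, positive I Z /\ katetov_le ED (restrict I Z)).
  by right.
left; have /choice[Phi PhiP] : forall X : nat -> Prop, exists Y : nat -> nat -> Prop,
    ~ I X -> [/\ forall i, ~ I (Y i), forall i n, Y i n -> X n &
      forall A, I A -> exists i, forall n, Y i n -> ~ A n].
  move=> X; have [IX|Xpos] := pselect (I X); first by exists (fun _ => X).
  by have [//|[Y YP]] := positive_dichotomy I X iI I1 cI Xpos; exists Y.
exact: katetov_nwd_of_families PhiP.
Qed.
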